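(* Let $p$ be a prime, let $\varkappa$ be a cardinal, and let $k$ be a perfect field of characteristic $p$ such that the transcendence degree of $k$ over $\mathbb{F}_p$ is equal to $\varkappa$. Then every $H_p$-valued ultrametric space $(X,d)$ with either $X=\emptyset$ or $\mathrm{Card}(X\sqcup\{\ast\})\le\varkappa$ for some $\ast\notin X$ can be isometrically embedded into $(\mathrm{Frac}\,W(k),w_k)$, where the latter carries the metric $(x,y)\mapsto p^{-w_k(x-y)}$. In particular, for every odd prime $p$ and every $H_p$-valued metric space $(X,d)$, there exist a non-Archimedean Banach algebra $(B,\|\cdot\|)$ over $\mathbb{Q}_p$ and a distance-preserving map $i\colon X\to B$, where $B$ carries the metric $(x,y)\mapsto\|x-y\|$.
   Context: $H_p=\{0\}\cup\{p^n\mid n\in\mathbb{Z}\}$. A metric $d$ is $H_p$-valued if $d(x,y)\in H_p$ for all $x,y$; an ultrametric is a metric with $d(x,y)\le\max\{d(x,z),d(z,y)\}$. For a perfect field $k$ of characteristic $p>0$, $W(k)$ is the ring of Witt vectors of $k$: the unique complete valued ring $(W(k),w_k)$ of characteristic $0$ with residue class field $k$ and with valuation $w_k$, $w_k(p)=1$, having values $\mathbb{Z}_{\ge0}$ on nonzero elements. $\mathrm{Frac}\,W(k)$ is its fraction field, with the induced valuation still denoted $w_k$ (and $w_k(0)=\infty$, $p^{-\infty}=0$). Let $(K,|\cdot|)$ be a field with a non-Archimedean absolute value; $\mathbb{Q}_p$ carries the $p$-adic absolute value $|x|=p^{-v_p(x)}$. A non-Archimedean Banach algebra over $K$ is a $(B,\|\cdot\|)$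 such that: $B$ is a ring (not necessarily commutative or unitary); $(B,\|\cdot\|)$ is a normed linear space over $(K,|\cdot|)$; $\|x+y\|\le\max\{\|x\|,\|y\|\}$ and $\|xy\|\le\|x\|\cdot\|y\|$ for all $x,y\in B$; $B$ is complete with respect to $\|\cdot\|$; and if $B$ has a unit $e$ then $\|e\|=1$. *)

(* Defs.v *)
From HB Require Import structures.
From mathcomp Require Import all_boot all_order all_algebra.
From mathcomp Require Import all_classical all_reals all_analysis.
(* The notations of mpoly clash with those of MathComp-Analysis. *)
From mathcomp Require Import -(notations) mpoly.

Set Implicit Arguments.
Unset Strict Implicit.
Unset Printing Implicit Defensive.

Import Order.TTheory GRing.Theory Num.Theory.
Local Open Scope classical_set_scope.
Local Open Scope card_scope.
Local Open Scope quotient_scope.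
Local Open Scope ring_scope.

Definition Hp (R : realType) (p : nat) : set R :=
  [set r | r = 0 \/ exists n : int, r = p%:R ^ n].

Definition Hp_valued (R : realType) (p : nat) (X : metricType R) : Prop :=
  forall x y : X, Hp p (mdist x y).

Definition ultrametric (R : realType) (X : metricType R) : Prop :=
  forall x y z : X, mdist x y <= Num.max (mdist x z) (mdist z y).

Definition dist_complete (R : realType) (T : Type) (d : T -> T -> R) : Prop :=
  forall u : nat -> T,
    (forall e : R, 0 < e -> exists N : nat, forall m n : nat,
       (N <= m)%N -> (N <= n)%N -> d (u m) (u n) < e) ->
    exists l : T, forall e : R, 0 < e -> exists N : nat, forall n : nat,
      (N <= n)%N -> d (u n) l < e.

Definition subfield (K : fieldType) : set (set K) :=
  [set S | GRing.divring_closed (mem S)].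

Section Transcendence.
Variables (F K : fieldType) (iota : F -> K).

Definition algebraically_independent (B : set K) : Prop :=
  forall (n : nat) (v : 'I_n -> K), injective v -> (forall i, B (v i)) ->
  forall P : mpoly n F, mmap iota v P = 0 -> P = 0.

Definition algebraic_over (L : set K) (x : K) : Prop :=
  exists2 P : {poly K}, P != 0 & (forall i, L P`_i) /\ root P x.

Definition transcendence_basis (B : set K) : Prop :=
  algebraically_independent B /\
  forall x : K, algebraic_over (smallest (@subfield K) (range iota `|` B)) x.

End Transcendence.

(* When [p] is prime and [k] has characteristic [p], this is the unique ring
   morphism from ['F_p] to [k]. *)
Definition Fp_incl (p : nat) (k : fieldType) (a : 'F_p) : k := (a : nat)%:R.

(* The cardinal number is represented by a type [kappa] of that cardinality. *)
Definition trdeg_Fp (p : nat) (k : fieldType) (kappa : Type) : Prop :=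
  exists B : set k,
    transcendence_basis (@Fp_incl p k) B /\ B #= [set: kappa].

Definition perfect_pchar (p : nat) (k : fieldType) : Prop :=
  p \in [pchar k] /\ bijective (fun x : k => x ^+ p).

(* [p ^ (- v x)], with the convention [v 0 = +oo]: the value of [v] at [0] is
   irrelevant. *)
Definition val_abs (R : realType) (p : nat) (V : zmodType) (v : V -> int)
    (x : V) : R :=
  if x == 0 then 0 else p%:R ^ (- v x).

(* [(W, w)] is the ring of Witt vectors of the perfect field [k], which is
   determined by these properties up to isomorphism; [w 0] is irrelevant.
   [witt_valuation_ring] says that [W] is the valuation ring of [w] in its
   fraction field; without it, non-normal subrings such as Z_p + p W(F_{p^2})
   of W(F_{p^2}) would be allowed, with residue field F_p. *)
Record is_witt_ring (R : realType) (p : nat) (k : fieldType) (W : idomainType)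
    (w : W -> nat) : Prop := IsWittRing {
  witt_char0 : [pchar W] =i pred0 ;
  witt_valM : forall x y : W, x != 0 -> y != 0 -> w (x * y) = (w x + w y)%N ;
  witt_valD : forall x y : W, x != 0 -> y != 0 -> x + y != 0 ->
    (minn (w x) (w y) <= w (x + y)%R)%N ;
  witt_valp : w p%:R = 1%N ;
  witt_valuation_ring : forall x y : W, x != 0 -> y != 0 ->
    (w x <= w y)%N -> exists z : W, y = z * x ;
  witt_complete : dist_complete
    (fun x y : W => val_abs R p (fun z => (w z)%:Z) (x - y)) ;
  witt_residue : exists pi : {rmorphism W -> k},
    (forall a : k, exists x : W, pi x = a) /\
    (forall x : W, pi x = 0 <-> x = 0 \/ (0 < w x)%N)
}.

(* The valuation induced by [w] on the fraction field: [repr x] is a numerator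
   and denominator of [x]. *)
Definition frac_val (W : idomainType) (w : W -> nat) (x : {fraction W}) : int :=
  let: (a, b) := frac (repr x) in (w a)%:Z - (w b)%:Z.

Definition padic_val (p : nat) (q : rat) : int :=
  (logn p `|numq q|%N)%:Z - (logn p `|denq q|%N)%:Z.

Record nonarch_abs (R : realType) (K : fieldType) (abs : K -> R) : Prop :=
    NonarchAbs {
  nonarch_abs_ge0 : forall x : K, 0 <= abs x ;
  nonarch_abs_eq0 : forall x : K, abs x = 0 <-> x = 0 ;
  nonarch_absM : forall x y : K, abs (x * y) = abs x * abs y ;
  nonarch_absD : forall x y : K, abs (x + y) <= Num.max (abs x) (abs y)
}.

(* [(K, abs)] is the field of p-adic numbers, i.e. the completion of the field
   of rational numbers for the p-adic absolute value; this determines it up to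
   a unique isometric isomorphism. *)
Record is_padic_field (R : realType) (p : nat) (K : fieldType) (abs : K -> R) :
    Prop := IsPadicField {
  padic_nonarch : nonarch_abs abs ;
  padic_abs_rat : forall q : rat, abs (ratr q) = val_abs R p (padic_val p) q ;
  padic_complete : dist_complete (fun x y : K => abs (x - y)) ;
  padic_dense : forall (x : K) (e : R), 0 < e ->
    exists q : rat, abs (x - ratr q) < e
}.

(* The multiplication [mul] is explicit because [B] need not have a unit. *)
Record nonarch_banach_algebra (R : realType) (K : fieldType) (abs : K -> R)
    (B : lmodType K) (mul : B -> B -> B) (norm : B -> R) : Prop :=
    NonarchBanachAlgebra {
  banach_mulA : forall x y z : B, mul x (mul y z) = mul (mul x y) z ;
  banach_mulDl : forall x y z : B, mul (x + y) z = mul x z + mul y z ;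
  banach_mulDr : forall x y z : B, mul x (y + z) = mul x y + mul x z ;
  banach_mulZl : forall (a : K) (x y : B), mul (a *: x) y = a *: mul x y ;
  banach_mulZr : forall (a : K) (x y : B), mul x (a *: y) = a *: mul x y ;
  banach_norm_ge0 : forall x : B, 0 <= norm x ;
  banach_norm_eq0 : forall x : B, norm x = 0 <-> x = 0 ;
  banach_normZ : forall (a : K) (x : B), norm (a *: x) = abs a * norm x ;
  banach_normD : forall x y : B, norm (x + y) <= Num.max (norm x) (norm y) ;
  banach_normM : forall x y : B, norm (mul x y) <= norm x * norm y ;
  banach_complete : dist_complete (fun x y : B => norm (x - y)) ;
  banach_norm_unit : forall e : B,
    (forall x : B, mul e x = x /\ mul x e = x) -> norm e = 1
}.

(* Main.v *)
(** A transcendence basis of k has cardinality kappa, so X injects into the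
    residue field k; lift this injection to W(k).
    Choosing one representative in each open ball of radius p^n gives digits
    a_n(x) in W(k) which depend only on the ball B(x, p^n) and are distinct modulo
    p for distinct balls of the same radius. With a base point x0, put
      f(x) = \sum_(n <= N) p^(-n) (a_n(x) - a_n(x0)),
    which converges p-adically and does not depend on the large integer N, as the
    terms with p^n > d(x, x0) vanish. In f(x) - f(y) the terms with
    p^n > d(x, y) cancel, and the one with p^n = d(x, y) has absolute value p^n and
    dominates the others.

    For odd p an H_p-valued metric is an ultrametric: two distances
    smaller than p^n add up to at most 2 p^(n-1) < p^n. In the Banach algebra of
    bounded functions X x Z -> Q_p with the sup norm, the functions
      F_x(z, n) = p^(-n) if d(x, z) < p^n, and 0 otherwise,
    satisfy |F_x - F_y| = d(x, y), the maximum being reached at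
    (x, n) with p^n = d(x, y); subtracting F_x0 makes them bounded. *)

Require Import Defs.
From HB Require Import structures.
From mathcomp Require Import all_boot all_order all_algebra.
From mathcomp Require Import all_classical all_reals all_analysis.
From mathcomp Require Import zify.

Set Implicit Arguments.
Unset Strict Implicit.
Unset Printing Implicit Defensive.

Import Order.TTheory GRing.Theory Num.Theory.
Local Open Scope classical_set_scope.
Local Open Scope card_scope.
Local Open Scope ring_scope.

(** * Real powers of [p], and elements of a fraction field as quotients *)

Lemma exprzN_lt (R : realType) (p : nat) (e : R) : (1 < p)%N -> 0 < e ->
  exists m : nat, p%:R ^ (- m%:Z) < e.
Proof.
move=> p1 e0; have p0 : 0 < p%:R :> R by rewrite ltr0n; lia.
exists (Num.Def.archi_bound e^-1).
have h : e^-1 < 2 ^+ Num.Def.archi_bound e^-1 by exact: upper_nthrootP.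
rewrite -exprnN -[ltRHS]invrK ltf_pV2 ?posrE ?exprn_gt0 ?invr_gt0//.
by apply: lt_le_trans h _; apply: lerXn2r; rewrite ?nnegrE ?ler0n ?ler_nat.
Qed.

Local Notation "x %:F" := (tofrac x).

(** Gives access to [frac_val], which is computed on the representative chosen by [repr]. *)
Lemma fracE (W : idomainType) (x : {fraction W}) :
  x = (frac (repr x)).1%:F / (frac (repr x)).2%:F.
Proof.
have d0 : (frac (repr x)).2%:F != 0 :> {fraction W}.
  by rewrite tofrac_eq0 denom_ratioP.
apply: (mulIf d0); rewrite divfK// -{1}(reprK x); unlock FracField.tofrac.
rewrite -[LHS]FracField.pi_mul; apply/eqmodP.
rewrite /= FracField.equivfE /FracField.mulf.
rewrite !numden_Ratio ?mulr1 ?oner_neq0 ?denom_ratioP//.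
by rewrite mulrC.
Qed.

(** * Witt rings: divisibility by powers of [p], p-adic series, the valuation on fractions *)

Section WittRing.
Variables (R : realType) (p : nat) (k : fieldType) (W : idomainType) (w : W -> nat).
Hypothesis (p_prime : prime p) (hW : is_witt_ring R p k w).

Let p_gt1 : (1 < p)%N := prime_gt1 p_prime.
Let pR_gt1 : 1 < p%:R :> R. Proof. by rewrite ltr1n. Qed.

Lemma witt_p_neq0 : p%:R != 0 :> W.
Proof. by have := witt_char0 hW p; rewrite !inE p_prime => /negbT. Qed.

Lemma witt_val1 : w 1 = 0%N.
Proof.
have /eqP := witt_valM hW (oner_neq0 W) (oner_neq0 W).
by rewrite mulr1 -[eqbLHS]addn0 eqn_add2l => /eqP.
Qed.

Lemma witt_valX m : w (p%:R ^+ m) = m.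
Proof.
elim: m => [|m IH]; first exact: witt_val1.
by rewrite exprS (witt_valM hW) ?expf_neq0 ?witt_p_neq0// IH (witt_valp hW).
Qed.

Lemma witt_val_pM m z : z != 0 -> w (p%:R ^+ m * z) = (m + w z)%N.
Proof. by move=> z0; rewrite (witt_valM hW) ?expf_neq0 ?witt_p_neq0// witt_valX. Qed.

(** Translates metric estimates into divisibility, so that convergence can be treated by ring
    computations. The direct implication rests on [W] being the valuation ring of [w]. *)
Lemma val_abs_le_dvd m (x : W) :
  val_abs R p (fun z => (w z)%:Z) x <= p%:R ^ (- m%:Z) <->
  exists z, x = p%:R ^+ m * z.
Proof.
rewrite /val_abs; split=> [|[z ->]].
  have [->|x0] := eqVneq x 0; first by exists 0; rewrite mulr0.
  rewrite ler_eXz2l// lerN2 lez_nat -{1}(witt_valX m) => h.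
  have [z ->] := witt_valuation_ring hW (expf_neq0 m witt_p_neq0) x0 h.
  by exists z; rewrite mulrC.
case: ifPn => [_|]; first by rewrite exprz_ge0// ler0n.
rewrite mulf_eq0 => /norP[_ z0].
by rewrite ler_eXz2l// lerN2 lez_nat witt_val_pM// leq_addr.
Qed.

(** A nonzero [x] divisible by p^(w(x)+1) would have valuation above [w x]. *)
Lemma witt_separated (x : W) : (forall m, exists z, x = p%:R ^+ m * z) -> x = 0.
Proof.
move=> h; apply/eqP/negPn/negP => x0; have [z xE] := h (w x).+1.
have z0 : z != 0 by apply: contraNneq x0 => z0; rewrite xE z0 mulr0.
by have := witt_val_pM (w x).+1 z0; rewrite -xE; lia.
Qed.

Lemma padic_partial_sumB (b : nat -> W) m n : (m <= n)%N ->
  exists z, \sum_(j < n) b j * p%:R ^+ j - \sum_(j < m) b j * p%:R ^+ j =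
            p%:R ^+ m * z.
Proof.
move=> /subnKC <-; elim: (n - m)%N => [|i [z IH]].
  by exists 0; rewrite addn0 subrr mulr0.
exists (z + b (m + i)%N * p%:R ^+ i).
by rewrite addnS big_ord_recr/= addrAC IH exprD mulrDr mulrCA.
Qed.

Lemma padic_series_exists (b : nat -> W) : exists S : W, forall m,
  exists z, S = \sum_(j < m) b j * p%:R ^+ j + p%:R ^+ m * z.
Proof.
pose u n := \sum_(j < n) b j * p%:R ^+ j.
have uB N m n : (N <= m)%N -> (N <= n)%N -> exists z, u m - u n = p%:R ^+ N * z.
  move=> /(padic_partial_sumB b)[y um] /(padic_partial_sumB b)[z un].
  by exists (y - z); rewrite mulrBr -um -un opprB subrKA.
have [|S uS] := witt_complete hW (u := u).
  move=> e e0; have [N Ne] := exprzN_lt p_gt1 e0.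
  exists N => m n Nm Nn; apply: le_lt_trans Ne.
  exact/val_abs_le_dvd/uB.
exists S => m.
(* Modulo p^m the limit agrees with a late partial sum, and that one with the [m]-th. *)
have [|N uSm] := uS (p%:R ^ (- m%:Z)); first by rewrite exprz_gt0// ltr0n ltnW.
have /ltW/val_abs_le_dvd[z zE] := uSm (maxn N m) (leq_maxl _ _).
have [y yE] := uB m _ _ (leq_maxr N m) (leqnn m).
by exists (y - z); rewrite mulrBr -zE -yE opprB [X in _ + X]addrC subrKA addrC subrK.
Qed.

Definition padic_series (b : nat -> W) : W := projT1 (cid (padic_series_exists b)).

Lemma padic_seriesP (b : nat -> W) m :
  exists z, padic_series b = \sum_(j < m) b j * p%:R ^+ j + p%:R ^+ m * z.
Proof. exact: (projT2 (cid (padic_series_exists b))). Qed.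

(** Both sides agree modulo every power of [p]. The left series is cut one term later, as the right
    one is multiplied by [p]. *)
Lemma padic_seriesS (b : nat -> W) :
  padic_series b = b 0%N + p%:R * padic_series (fun j => b j.+1).
Proof.
apply/eqP; rewrite -subr_eq0; apply/eqP/witt_separated => m.
have [y ->] := padic_seriesP b m.+1.
have [z ->] := padic_seriesP (fun j => b j.+1) m.
exists (p%:R * (y - z)); rewrite big_ord_recl expr0 mulr1.
under eq_bigr do rewrite lift0 exprS mulrCA.
rewrite -mulr_sumr mulrDr addrA opprD addrACA subrr add0r.
by rewrite !mulrBr !mulrA -exprSr -exprS.
Qed.

(** Cross-multiplying with the chosen representative gives an equality of products in [W], where [w]
    is additive; hence the choice does not matter. *)
Lemma frac_val_div (a b : W) : a != 0 -> b != 0 ->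
  frac_val w (a%:F / b%:F) = (w a)%:Z - (w b)%:Z.
Proof.
move=> a0 b0; rewrite /frac_val; have := fracE (a%:F / b%:F).
have := denom_ratioP (repr (a%:F / b%:F)).
case: (frac _) => c d/= d0 /eqP.
have F0 z : z != 0 -> z%:F != 0 by rewrite tofrac_eq0.
rewrite eqr_div ?F0// -!tofracM tofrac_eq => /eqP h.
have c0 : c != 0.
  apply: contraTneq a0 => c0; move/eqP: h.
  by rewrite c0 mul0r mulf_eq0 (negPf d0) orbF negbK.
by have := congr1 w h; rewrite !(witt_valM hW)//; lia.
Qed.

Lemma frac_valM (x y : {fraction W}) : x != 0 -> y != 0 ->
  frac_val w (x * y) = frac_val w x + frac_val w y.
Proof.
rewrite (fracE x) (fracE y).
move: (denom_ratioP (repr x)) (denom_ratioP (repr y)).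
case: (frac (repr x)) (frac (repr y)) => [a b] [c d]/= b0 d0.
rewrite !mulf_eq0 !invr_eq0 !tofrac_eq0 (negPf b0) (negPf d0) !orbF => a0 c0.
rewrite mulf_div -!tofracM !frac_val_div ?mulf_neq0// !(witt_valM hW)//; lia.
Qed.

Lemma frac_val_tofrac (a : W) : a != 0 -> frac_val w a%:F = (w a)%:Z.
Proof.
move=> a0; rewrite -[a%:F]divr1 -tofrac1 frac_val_div ?oner_neq0// witt_val1; lia.
Qed.

Lemma frac_val_pX (n : int) : frac_val w (p%:R ^ n) = n.
Proof.
have pF : p%:R = p%:R%:F :> {fraction W} by rewrite rmorph_nat.
have pX0 m : p%:R ^+ m != 0 :> W by rewrite expf_neq0 ?witt_p_neq0.
have F1 m : p%:R ^+ m = (p%:R ^+ m)%:F :> {fraction W} by rewrite tofracXn -pF.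
case: (intP n) => [|m|m]; first by
  rewrite expr0z -tofrac1 frac_val_tofrac ?oner_neq0// witt_val1.
  by rewrite [_ ^ _]F1 frac_val_tofrac// witt_valX.
rewrite -exprnN F1 -[_^-1]mul1r -tofrac1 frac_val_div ?oner_neq0//.
by rewrite witt_valX witt_val1 sub0r.
Qed.

Lemma val_abs_fracM (x y : {fraction W}) :
  val_abs R p (frac_val w) (x * y) =
  val_abs R p (frac_val w) x * val_abs R p (frac_val w) y.
Proof.
rewrite /val_abs mulf_eq0.
have [|x0] := eqVneq x 0; first by rewrite mul0r.
have [|y0] := eqVneq y 0; first by rewrite mulr0.
by rewrite /= frac_valM// opprD expfzDr// gt_eqF// ltr0n ltnW.
Qed.

End WittRing.

(** * Balls in ultrametric spaces and the embedding into Frac W(k) *)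

Lemma mdist_lt_expz (R : realType) (p : nat) (X : metricType R) (x y : X) :
  (1 < p)%N -> Hp_valued p X ->
  exists N : int, forall n : int, N < n -> mdist x y < p%:R ^ n.
Proof.
move=> p1 /(_ x y) [->|[N ->]].
  by exists 0 => n _; rewrite exprz_gt0// ltr0n ltnW.
by exists N => n Nn; rewrite ltr_eXz2l// ltr1n.
Qed.

(** Every point of a ball is a centre of it. Equality as sets makes a choice function return the
    same point for both centres. *)
Lemma ultrametric_ball_eq (R : realType) (X : metricType R) (x y : X) (r : R) :
  ultrametric X -> mdist x y < r ->
  [set z | mdist x z < r] = [set z | mdist y z < r].
Proof.
move=> um xy; apply/seteqP; split=> z /= h.
  by apply: le_lt_trans (um y z x) _; rewrite gt_max (metric_sym y) xy h.
by apply: le_lt_trans (um x z y) _; rewrite gt_max xy h.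
Qed.

Lemma card_le_inj (T U : Type) : [set: T] #<= [set: U] ->
  exists f : T -> U, injective f.
Proof.
move=> /card_leP[f].
exists (fun t => set_val (f (SigSub (mem_setT t)))) => x y /val_inj fxy.
by have /(congr1 set_val) := 'inj_f (in_setT _) (in_setT _) fxy.
Qed.

Lemma witt_embedding (R : realType) (p : nat) (k : fieldType) (W : idomainType)
    (w : W -> nat) (X : metricType R) (g : X -> k) :
  prime p -> is_witt_ring R p k w -> Hp_valued p X -> ultrametric X ->
  injective g ->
  exists f : X -> {fraction W}, forall x y : X,
    val_abs R p (frac_val w) (f x - f y) = mdist x y.
Proof.
move=> p_prime hW hX um g_inj; have p1 := prime_gt1 p_prime.
have [[x0 _]|X0] := pselect (exists x0 : X, True); last first.
  by exists (fun=> 0) => x; case: X0; exists x.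
have [pi [pi_surj pi0]] := witt_residue hW.
have [s sK] := choice pi_surj.
(* The representative of the open ball of radius p^n around [x]; the default [x0] is never returned,
   as the ball contains [x]. *)
pose c (n : int) x := xget x0 [set y | mdist x y < p%:R ^ n].
have cP n x : mdist x (c n x) < p%:R ^ n.
  apply: (@xgetI _ x0 [set y | mdist x y < p%:R ^ n] x) => /=.
  by rewrite mdistxx exprz_gt0// ltr0n ltnW.
have c_eq n x y : mdist x y < p%:R ^ n -> c n x = c n y.
  by move=> xy; rewrite /c (ultrametric_ball_eq um xy).
have c_neq n x y : mdist x y = p%:R ^ n -> c n x != c n y.
  move=> xy; apply: contra_eq_neq xy => cxy; rewrite lt_eqF//.
  by apply: le_lt_trans (um x y (c n x)) _; rewrite gt_max cP cxy metric_sym cP.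
pose b (n : int) x := s (g (c n x)) - s (g (c n x0)).
pose S (n : int) x := padic_series p_prime hW (fun j : nat => b (n - j%:Z) x).
have SS n x : S n x = b n x + p%:R * S (n - 1) x.
  rewrite /S padic_seriesS subr0; congr (_ + _ * padic_series _ _ _).
  by apply/funext => j; congr (b _ x); lia.
pose P : {fraction W} := p%:R.
have P0 : P != 0.
  by rewrite /P -(rmorph_nat (@tofrac W)) tofrac_eq0 (witt_p_neq0 p_prime hW).
(* This is the sum of p^(-m) b_m(x) over all m <= n, the index [j] in [S] standing for m = n - j. *)
pose F n x := P ^ (- n) * (S n x)%:F.
have FS n x : F n x = P ^ (- n) * (b n x)%:F + F (n - 1) x.
  by rewrite /F SS tofracD tofracM rmorph_nat mulrDr mulrA opprB [1 - n]addrC expfzDr.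
have F_stable M i x : (forall n, M < n -> b n x = 0) -> F (M + i%:Z) x = F M x.
  move=> bx0; elim: i => [|i <-]; first by rewrite addr0.
  rewrite FS bx0 ?tofrac0 ?mulr0 ?add0r; last by lia.
  by congr F; lia.
have F_stableB M i x y : (forall n, M < n -> b n x = b n y) ->
    F (M + i%:Z) x - F (M + i%:Z) y = F M x - F M y.
  move=> bxy; elim: i => [|i <-]; first by rewrite addr0.
  rewrite (FS _ x) (FS _ y) bxy; last by lia.
  by rewrite [X in X - _]addrC addrKA; congr (F _ _ - F _ _); lia.
have [N N_lt] := choice (fun x => mdist_lt_expz x x0 p1 hX).
have bN x n : N x < n -> b n x = 0.
  by move=> /(N_lt x) /c_eq cx; rewrite /b cx subrr.
exists (fun x => F (N x) x) => x y.
have [<-|xy] := eqVneq x y; first by rewrite subrr /val_abs eqxx mdistxx.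
case: (hX x y) => [/mdist_positivity xyE|[M dM]].
  by rewrite xyE eqxx in xy.
(* A common cutoff: beyond [N x] and [N y] the digits vanish, so both images are sums up to [L];
   between [M] and [L] the digits of [x] and [y] agree and cancel. *)
pose L := Num.max M (Num.max (N x) (N y)).
have FE z n : N z <= n -> F (N z) z = F n z.
  move=> Nzn; rewrite -(F_stable _ `|n - N z|%N z (@bN z)).
  by congr F; lia.
rewrite (FE x L) ?(FE y L); [|by lia|by lia].
have -> : L = M + (`|L - M|%N)%:Z by lia.
rewrite F_stableB; last first.
  move=> n Mn; rewrite /b (c_eq n x y)// dM ltr_eXz2l// ltr1n//.
pose u := b M x - b M y + p%:R * (S (M - 1) x - S (M - 1) y).
have -> : F M x - F M y = P ^ (- M) * u%:F.
  by rewrite /F -mulrBr -tofracB (SS _ x) (SS _ y) /u mulrBr opprD addrACA.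
(* Modulo [p] only the leading digits remain, and they differ because [g] is injective; so [u] has
   valuation 0. *)
have pi_u : pi u <> 0.
  have pip : pi p%:R = 0 by apply/pi0; right; rewrite (witt_valp hW).
  rewrite /u rmorphD rmorphM pip mul0r addr0 /b opprB addrA subrK rmorphB !sK.
  by move=> /subr0_eq /g_inj; apply/eqP/c_neq.
have [u0 wu0] : u != 0 /\ w u = 0%N.
  split; first by apply/eqP => u0; apply: pi_u; rewrite u0 rmorph0.
  by apply/eqP; rewrite -leqn0 leqNgt; apply/negP => wu; apply/pi_u/pi0; right.
rewrite (val_abs_fracM p_prime hW) /val_abs tofrac_eq0 (negPf u0).
rewrite (negPf (expfz_neq0 _ P0)) (frac_val_pX p_prime hW).
by rewrite (frac_val_tofrac p_prime hW)// wu0 oppr0 expr0z mulr1 opprK dM.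
Qed.

(** * Non-Archimedean absolute values and the Banach algebra of bounded functions *)

Section NonarchAbs.
Variables (R : realType) (K : fieldType) (abs : K -> R).
Hypothesis abs_na : nonarch_abs abs.

Lemma nonarch_abs0 : abs 0 = 0.
Proof. exact/(nonarch_abs_eq0 abs_na). Qed.

Lemma nonarch_abs_neq0 x : x != 0 -> abs x != 0.
Proof. by apply: contra_neq => /(nonarch_abs_eq0 abs_na). Qed.

Lemma nonarch_abs1 : abs 1 = 1.
Proof.
apply: (mulfI (nonarch_abs_neq0 (oner_neq0 K))).
by rewrite -(nonarch_absM abs_na) !mulr1.
Qed.

Lemma nonarch_absN x : abs (- x) = abs x.
Proof.
have abs_sq1 : abs (-1) ^+ 2 = 1.
  by rewrite expr2 -(nonarch_absM abs_na) mulrNN mulr1 nonarch_abs1.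
have absN1 : abs (-1) = 1.
  by apply/eqP; rewrite -sqrp_eq1 ?abs_sq1 // (nonarch_abs_ge0 abs_na).
by rewrite -mulN1r (nonarch_absM abs_na) absN1 mul1r.
Qed.

Lemma nonarch_absB x y : abs (x - y) <= Num.max (abs x) (abs y).
Proof. by rewrite -(nonarch_absN y); apply: (nonarch_absD abs_na). Qed.

Lemma nonarch_absV x : abs x^-1 = (abs x)^-1.
Proof.
have [->|x0] := eqVneq x 0; first by rewrite invr0 nonarch_abs0 invr0.
apply: (mulfI (nonarch_abs_neq0 x0)).
by rewrite -(nonarch_absM abs_na) !divff ?nonarch_abs_neq0// nonarch_abs1.
Qed.

Lemma nonarch_absXz x (n : int) : abs (x ^ n) = abs x ^ n.
Proof.
have absX m : abs (x ^+ m) = abs x ^+ m.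
  elim: m => [|m IH]; first exact: nonarch_abs1.
  by rewrite !exprS (nonarch_absM abs_na) IH.
case: (intP n) => [|m|m]; first by rewrite !expr0z nonarch_abs1.
  by rewrite -!exprnP absX.
by rewrite -!exprnN nonarch_absV absX.
Qed.

(** With [r] itself as tolerance, pass through one late [u n]: the strong triangle inequality loses
    nothing. *)
Lemma nonarch_dist_lim_le (u : nat -> K) (l z : K) (r : R) :
  (forall e, 0 < e -> exists N, forall n, (N <= n)%N -> abs (u n - l) < e) ->
  0 < r -> (exists N, forall n, (N <= n)%N -> abs (z - u n) <= r) -> abs (z - l) <= r.
Proof.
move=> ul r0 [N zu]; have [M uM] := ul r r0.
have -> : z - l = (z - u (maxn N M)) + (u (maxn N M) - l) by rewrite subrKA.
apply: le_trans (nonarch_absD abs_na _ _) _; rewrite ge_max.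
by rewrite zu ?leq_maxl// ltW// uM// leq_maxr.
Qed.

Section BoundedFunctions.
Variable T : Type.

(* The unused argument makes the proof of [nonarch_abs abs] recoverable from the
   type, as the canonical instances below require. *)
Definition bounded_fun_pred of nonarch_abs abs : {pred T -> K^o} :=
  fun f => `[< exists M, forall t, abs (f t) <= M >].

Lemma bounded_fun_submod : submod_closed (bounded_fun_pred abs_na).
Proof.
split=> [|a f g /asboolP[M fM] /asboolP[N gN]]; apply/asboolP.
  by exists 0 => t; rewrite nonarch_abs0.
exists (Num.max (abs a * M) N) => t.
apply: le_trans (nonarch_absD abs_na _ _) _.
rewrite ge_max !le_max gN orbT andbT (nonarch_absM abs_na).
by rewrite ler_wpM2l// (nonarch_abs_ge0 abs_na).
Qed.

HB.instance Definition _ :=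
  GRing.isSubmodClosed.Build K (T -> K^o) (bounded_fun_pred abs_na) bounded_fun_submod.

Record bounded_fun := BoundedFun {
  bounded_fun_val :> T -> K^o;
  bounded_funP : bounded_fun_val \in bounded_fun_pred abs_na }.

HB.instance Definition _ := [isSub for bounded_fun_val].
HB.instance Definition _ := [Choice of bounded_fun by <:].
HB.instance Definition _ := [SubChoice_isSubLmodule of bounded_fun by <:].

Implicit Types f g : bounded_fun.

Definition sup_norm f : R := sup [set abs (f t) | t in [set: T]].

Lemma bounded_fun_has_ubound f : has_ubound [set abs (f t) | t in [set: T]].
Proof. by have /asboolP[M fM] := bounded_funP f; exists M => _ [t _ <-]. Qed.

Lemma abs_le_sup_norm f t : abs (f t) <= sup_norm f.
Proof. by apply: ub_le_sup; [exact: bounded_fun_has_ubound|exists t]. Qed.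

Fact bounded_fun_mul_subproof f g :
  (fun t => f t * g t) \in bounded_fun_pred abs_na.
Proof.
apply/asboolP; exists (sup_norm f * sup_norm g) => t.
by rewrite (nonarch_absM abs_na) ler_pM ?(nonarch_abs_ge0 abs_na)// abs_le_sup_norm.
Qed.

Definition bounded_fun_mul f g := BoundedFun (bounded_fun_mul_subproof f g).

Lemma bounded_fun_ext f g : (forall t, f t = g t) -> f = g.
Proof. by move=> fg; apply: val_inj; apply/funext. Qed.

(** A point makes the set of values nonempty, so that its supremum is a least upper bound and the
    unit has norm 1. *)
Variable t0 : T.

Lemma sup_norm_le f M : (forall t, abs (f t) <= M) -> sup_norm f <= M.
Proof. by move=> fM; apply: ge_sup => [|_ [t _ <-]//]; exists (abs (f t0)), t0. Qed.

Lemma sup_norm_ge0 f : 0 <= sup_norm f.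
Proof. exact: le_trans (nonarch_abs_ge0 abs_na _) (abs_le_sup_norm f t0). Qed.

Lemma sup_norm_eq0 f : sup_norm f = 0 <-> f = 0.
Proof.
split=> [f0|->]; last first.
  by apply/eqP; rewrite eq_le sup_norm_ge0 sup_norm_le// => t; rewrite nonarch_abs0.
apply: bounded_fun_ext => t; apply/(nonarch_abs_eq0 abs_na)/eqP.
by rewrite eq_le (nonarch_abs_ge0 abs_na) -f0 abs_le_sup_norm.
Qed.

Lemma sup_normZ a f : sup_norm (a *: f) = abs a * sup_norm f.
Proof.
have [->|a0] := eqVneq a 0.
  by rewrite scale0r nonarch_abs0 mul0r; apply/sup_norm_eq0.
have abs_a0 : 0 < abs a.
  by rewrite lt_neqAle eq_sym nonarch_abs_neq0// (nonarch_abs_ge0 abs_na).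
apply/eqP; rewrite eq_le; apply/andP; split.
  apply: sup_norm_le => t; rewrite (nonarch_absM abs_na).
  by rewrite ler_wpM2l ?abs_le_sup_norm// ltW.
(* For the reverse inequality, divide by [abs a] and compare pointwise. *)
rewrite mulrC -ler_pdivlMr//; apply: sup_norm_le => t.
rewrite ler_pdivlMr// mulrC -(nonarch_absM abs_na).
exact: (abs_le_sup_norm (a *: f)).
Qed.

Lemma sup_normD f g : sup_norm (f + g) <= Num.max (sup_norm f) (sup_norm g).
Proof.
apply: sup_norm_le => t; apply: le_trans (nonarch_absD abs_na _ _) _.
by rewrite ge_max !le_max !abs_le_sup_norm orbT.
Qed.

Lemma sup_normM f g : sup_norm (bounded_fun_mul f g) <= sup_norm f * sup_norm g.
Proof.
apply: sup_norm_le => t.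
by rewrite (nonarch_absM abs_na) ler_pM ?(nonarch_abs_ge0 abs_na)// abs_le_sup_norm.
Qed.

(** Multiplying [f] by the constant function 1, which is bounded, shows that [f] is this
    constant. *)
Lemma sup_norm_unit f : (forall g, bounded_fun_mul f g = g) -> sup_norm f = 1.
Proof.
move=> fg; have one_bounded : (fun=> 1) \in bounded_fun_pred abs_na.
  by apply/asboolP; exists 1 => t; rewrite nonarch_abs1.
have f1 t : f t = 1.
  have /(congr1 (fun h : bounded_fun => h t)) := fg (BoundedFun one_bounded).
  by rewrite /= mulr1.
apply/eqP; rewrite eq_le; apply/andP; split.
  by apply: sup_norm_le => t; rewrite f1 nonarch_abs1.
by apply: le_trans (abs_le_sup_norm f t0); rewrite f1 nonarch_abs1.
Qed.

Lemma sup_norm_complete : dist_complete (fun x y : K => abs (x - y)) ->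
  dist_complete (fun f g => sup_norm (f - g)).
Proof.
move=> K_complete u u_cauchy.
have u_dist m n t : abs (u m t - u n t) <= sup_norm (u m - u n).
  exact: (abs_le_sup_norm (u m - u n)).
have /choice[l lP] t : exists l : K, forall e, 0 < e ->
    exists N, forall n, (N <= n)%N -> abs (u n t - l) < e.
  apply: (K_complete (fun n => u n t)) => e /u_cauchy[N uN]; exists N => m n Nm Nn.
  exact: le_lt_trans (u_dist m n t) (uN m n Nm Nn).
(* Letting the second index of the Cauchy condition tend to infinity gives a bound uniform in
   [t]. *)
have ul_le e : 0 < e -> exists N, forall n, (N <= n)%N ->
    forall t, abs (u n t - l t) <= e.
  move=> e0; have [N uN] := u_cauchy e e0; exists N => n Nn t.
  apply: nonarch_dist_lim_le (lP t) e0 _; exists N => m Nm.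
  exact: le_trans (u_dist n m t) (ltW (uN n m Nn Nm)).
have l_bounded : l \in bounded_fun_pred abs_na.
  have [N uN] := ul_le 1 ltr01; apply/asboolP.
  exists (Num.max (sup_norm (u N)) 1) => t.
  have -> : l t = u N t - (u N t - l t) by rewrite opprB addrC subrK.
  apply: le_trans (nonarch_absB _ _) _.
  by rewrite ge_max !le_max abs_le_sup_norm uN ?orbT.
exists (BoundedFun l_bounded) => e e0.
(* Half of [e], since a pointwise bound passes to the supremum only as a weak inequality. *)
have [|N uN] := ul_le (e / 2); first by rewrite divr_gt0.
exists N => n Nn; apply: le_lt_trans (_ : e / 2 < e).
  exact/sup_norm_le/uN.
by rewrite ltr_pdivrMr// ltr_pMr// ltr1n.
Qed.

Lemma bounded_fun_banach : dist_complete (fun x y : K => abs (x - y)) ->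
  nonarch_banach_algebra abs bounded_fun_mul sup_norm.
Proof.
move=> K_complete; split.
- by move=> f g h; apply: bounded_fun_ext => t; exact: mulrA.
- by move=> f g h; apply: bounded_fun_ext => t; exact: mulrDl.
- by move=> f g h; apply: bounded_fun_ext => t; exact: mulrDr.
- by move=> a f g; apply: bounded_fun_ext => t; exact/esym/mulrA.
- by move=> a f g; apply: bounded_fun_ext => t; exact: mulrCA.
- exact: sup_norm_ge0.
- exact: sup_norm_eq0.
- exact: sup_normZ.
- exact: sup_normD.
- exact: sup_normM.
- exact: sup_norm_complete.
- by move=> f fE; apply: sup_norm_unit => g; have [] := fE g.
Qed.

End BoundedFunctions.
End NonarchAbs.

(** * Odd primes: the ultrametric inequality and the embedding over the p-adic numbers *)

Lemma odd_Hp_ultrametric (R : realType) (p : nat) (X : metricType R) :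
  prime p -> odd p -> Hp_valued p X -> ultrametric X.
Proof.
move=> p_prime p_odd hX x y z; have p_gt2 := odd_prime_gt2 p_odd p_prime.
have p_gt1 : 1 < p%:R :> R by rewrite ltr1n ltnW.
rewrite leNgt gt_max; apply/negP => /andP[].
case: (hX x y) => [->|[n dn]]; first by rewrite ltNge mdist_ge0.
(* The values are discrete: below p^n the next one is p^(n-1). *)
have step (u v : X) : mdist u v < mdist x y -> mdist u v <= p%:R ^ (n - 1).
  rewrite dn; case: (hX u v) => [->|[m ->]]; first by rewrite exprz_ge0.
  by rewrite ltr_eXz2l// ler_eXz2l//; lia.
move=> /step xz /step zy; have := metric_triangle x z y.
rewrite leNgt => /negP; apply; apply: le_lt_trans (lerD xz zy) _.
have pR_neq0 : p%:R != 0 :> R by rewrite gt_eqF// (lt_trans ltr01).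
have -> : mdist x y = p%:R ^ (n - 1) * p%:R.
  by rewrite dn -{1}(subrK 1 n) (expfzDr (n - 1) 1 pR_neq0).
by rewrite -mulr2n -[ltLHS]mulr_natr ltr_pM2l ?exprz_gt0 ?ltr_nat ?ltr0n ?prime_gt0.
Qed.

Lemma padic_absXz (R : realType) (p : nat) (Qp : fieldType) (abs : Qp -> R) (n : int) :
  prime p -> is_padic_field p abs -> abs (p%:R ^ n) = p%:R ^ (- n).
Proof.
move=> p_prime hQ; rewrite (nonarch_absXz (padic_nonarch hQ)) -exprz_inv.
(* It remains to find the absolute value of [p], which is read off from [p] as a rational number. *)
congr (_ ^ _); have := padic_abs_rat hQ p%:R.
rewrite ratr_nat => ->; rewrite /val_abs pnatr_eq0 gtn_eqF ?prime_gt0//.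
have -> : p%:R = p%:Z%:Q :> rat by [].
by rewrite /padic_val numq_int denq_int logn1 subr0 /= logn_prime// eqxx.
Qed.

Lemma padic_banach_embedding (R : realType) (p : nat) (Qp : fieldType)
    (abs : Qp -> R) (X : metricType R) :
  prime p -> is_padic_field p abs -> Hp_valued p X -> ultrametric X ->
  exists (B : lmodType Qp) (mul : B -> B -> B) (norm : B -> R),
    nonarch_banach_algebra abs mul norm /\
    exists i : X -> B, forall x y : X, norm (i x - i y) = mdist x y.
Proof.
move=> p_prime hQ hX um; have na := padic_nonarch hQ.
have banach T (t0 : T) := bounded_fun_banach na t0 (padic_complete hQ).
have [[x0 _]|X0] := pselect (exists x0 : X, True); last first.
  exists _, (@bounded_fun_mul _ _ _ na unit), (@sup_norm _ _ _ na unit).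
  split; first exact: banach.
  by exists (fun=> 0) => x; case: X0; exists x.
have p_gt1 : 1 < p%:R :> R by rewrite ltr1n prime_gt1.
pose a x (t : X * int) : Qp := if mdist x t.1 < p%:R ^ t.2 then p%:R ^ (- t.2) else 0.
have abs_p n : abs (p%:R ^ (- n)) = p%:R ^ n.
  by rewrite (padic_absXz _ p_prime hQ) opprK.
have abs_a x t : abs (a x t) <= p%:R ^ t.2.
  rewrite /a; case: ifP => _; first by rewrite abs_p.
  by rewrite (nonarch_abs0 na) exprz_ge0.
(* Either p^n is at most d(x, y) and bounds both values, or the balls of radius p^n around [x] and
   [y] coincide and the values are equal. *)
have a_dist x y t : abs (a x t - a y t) <= mdist x y.
  have [dt|dt] := leP (p%:R ^ t.2) (mdist x y).
    apply: le_trans (nonarch_absB na _ _) _.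
    by rewrite ge_max !(le_trans (abs_a _ _) dt).
  have xyt : (mdist x t.1 < p%:R ^ t.2) = (mdist y t.1 < p%:R ^ t.2).
    have /seteqP[sub sup] := ultrametric_ball_eq um dt.
    by apply/idP/idP => [/sub|/sup].
  by rewrite /a xyt subrr (nonarch_abs0 na) mdist_ge0.
have a_bounded x : (fun t => a x t - a x0 t) \in bounded_fun_pred na.
  by apply/asboolP; exists (mdist x x0) => t.
exists _, (@bounded_fun_mul _ _ _ na (X * int)), (@sup_norm _ _ _ na (X * int)).
split; first exact: (banach _ (x0, 0)).
exists (fun x => BoundedFun (a_bounded x)) => x y.
have iE t : (BoundedFun (a_bounded x) - BoundedFun (a_bounded y)) t = a x t - a y t.
  by rewrite [LHS]/= opprB addrA subrK.
apply/eqP; rewrite eq_le; apply/andP; split.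
  by apply: (sup_norm_le (x0, 0)) => t; rewrite iE.
case: (hX x y) => [->|[n dn]]; first exact: (sup_norm_ge0 (x0, 0)).
(* At this point [a x] is p^(-n), while [a y] is 0 because d(y, x) = p^n is not below p^n. *)
apply: le_trans (abs_le_sup_norm _ (x, n)).
rewrite iE /a /= mdistxx (metric_sym y) dn ltxx.
by rewrite exprz_gt0 ?ltr0n ?prime_gt0// subr0 abs_p.
Qed.

Theorem theorem4p8 (R : realType) :
  (forall (p : nat) (kappa : Type) (k : fieldType),
     prime p -> perfect_pchar p k -> trdeg_Fp p k kappa ->
   forall (W : idomainType) (w : W -> nat), is_witt_ring R p k w ->
   forall X : metricType R, Hp_valued p X -> ultrametric X ->
     ([set: X] = set0 \/ [set: option X] #<= [set: kappa]) ->
   exists f : X -> {fraction W}, forall x y : X,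
     val_abs R p (frac_val w) (f x - f y) = mdist x y)
  /\
  (forall p : nat, prime p -> odd p ->
   forall (Qp : fieldType) (abs : Qp -> R), is_padic_field p abs ->
   forall X : metricType R, Hp_valued p X ->
   exists (B : lmodType Qp) (mul : B -> B -> B) (norm : B -> R),
     nonarch_banach_algebra abs mul norm /\
     exists i : X -> B, forall x y : X, norm (i x - i y) = mdist x y).
Proof.
split=> [p kappa k p_prime k_perfect [B [_ /card_eqPle[_ kappaB]]] W w hW X hX um X_le
        |p p_prime p_odd Qp abs hQ X hX]; last first.
  exact: (padic_banach_embedding p_prime hQ hX (odd_Hp_ultrametric p_prime p_odd hX)).
case: X_le => [X0|X_le].
  by exists (fun=> 0) => x; have : [set: X] x by []; rewrite X0.
(* The cardinalities increase along [option X], [kappa], the transcendence basis [B] and [k]. *)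
have [|g g_inj] := @card_le_inj (option X) k.
  apply: card_le_trans X_le (card_le_trans kappaB _).
  exact: subset_card_le.
have gS_inj : injective (g \o Some) by move=> x y /g_inj[].
exact: (witt_embedding p_prime hW hX um gS_inj).
Qed.
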